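(* Let $H$ be a complex Hilbert space and let $A,B\in B(H)$. (1) If $A+B$ is invertible, then so is $|A|^2+|B|^2$. (2) If $A+B$ is invertible, then so are $|A|+|B|$ and $|A|^{2^n}+|B|^{2^n}$ for every $n\in\mathbb{N}$. (3) Assume here that $A,B\geq 0$ and let $\alpha,\beta\in\mathbb{C}$. If $\alpha A+\beta B$ is invertible, then $A+B$ is invertible.
   Context: $B(H)$ denotes the algebra of all bounded linear operators on $H$; invertible means invertible in $B(H)$. $A\geq 0$ (positive) means $\langle Ax,x\rangle\geq 0$ for all $x\in H$. For $A\in B(H)$, $|A|=\sqrt{A^*A}$ is the unique positive square root of $A^*A$. *)

(* Defs.v *)
From HB Require Import structures.
From mathcomp Require Import all_boot all_order all_algebra.
From mathcomp Require Import all_classical all_reals all_analysis.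
From mathcomp Require Export complex.

Set Implicit Arguments.
Unset Strict Implicit.
Unset Printing Implicit Defensive.

Import Order.TTheory GRing.Theory Num.Theory.
Import numFieldNormedType.Exports.

Local Open Scope classical_set_scope.
Local Open Scope ring_scope.
Local Open Scope complex_scope.

(* A complex Hilbert space: a Banach space over [R[i]] whose norm comes from an
   inner product.  The inner product is linear in its first argument and
   conjugate-linear in the second. *)
HB.mixin Record CompleteNormedModule_isHilbert (R : realType) (H : Type)
    of CompleteNormedModule R[i] H := {
  dotp : {dot H for (@Num.conj R[i])} ;
  dotp_norm : forall x : H, `|x| ^+ 2 = dotp x x
}.

#[short(type="hilbertType")]
HB.structure Definition Hilbert (R : realType) :=
  {H of CompleteNormedModule R[i] H & CompleteNormedModule_isHilbert R H}.

Section BoundedOperators.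
Context {R : realType} {H : hilbertType R}.
Implicit Types f g : H -> H.

Definition bounded_linear f : Prop :=
  linear f /\ exists M : R, forall x : H, `|f x| <= M%:C * `|x|.

Definition bounded_linear_pred : {pred (H -> H)} := [pred f | `[< bounded_linear f >]].

Lemma bounded_linear_ge0 f : bounded_linear f ->
  exists2 M : R, 0 <= M & forall x : H, `|f x| <= M%:C * `|x|.
Proof.
move=> [_ [M fM]]; exists (Num.max 0 M); first by rewrite le_max lexx.
move=> x; apply: (le_trans (fM x)); apply: ler_wpM2r => //.
by rewrite lecR le_max lexx orbT.
Qed.

Lemma bounded_linear_submod : submod_closed bounded_linear_pred.
Proof.
split.
  apply/asboolP; split; first by move=> a x y /=; rewrite scaler0 addr0.
  by exists 0 => x; rewrite normr0 mul0r.
move=> a f g /asboolP bf /asboolP bg; apply/asboolP.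
have [M M0 fM] := bounded_linear_ge0 bf; have [N N0 gN] := bounded_linear_ge0 bg.
case: bf bg => [lf _] [lg _]; split.
  move=> b x y; rewrite !fctE lf lg !scalerDr !scalerA addrACA.
  by rewrite [a * b]mulrC.
exists (complex.Re `|a| * M + N) => x.
apply: (le_trans (ler_normD _ _)).
have aE : (complex.Re `|a|)%:C = `|a| by exact/RRe_real/normr_real.
rewrite rmorphD rmorphM /= aE mulrDl lerD// normrZ -mulrA.
by rewrite ler_wpM2l.
Qed.

HB.instance Definition _ :=
  GRing.isSubmodClosed.Build R[i] (H -> H) bounded_linear_pred
    bounded_linear_submod.

Lemma bounded_linear_id : bounded_linear id.
Proof. by split=> //; exists 1 => x; rewrite mul1r. Qed.

Lemma bounded_linear_comp f g :
  bounded_linear f -> bounded_linear g -> bounded_linear (f \o g).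
Proof.
move=> bf bg; have [M M0 fM] := bounded_linear_ge0 bf.
have [N N0 gN] := bounded_linear_ge0 bg.
case: bf bg => [lf _] [lg _]; split; first by move=> a x y /=; rewrite lg lf.
exists (M * N) => x /=; apply: (le_trans (fM _)).
by rewrite rmorphM /= -mulrA ler_wpM2l// lecR.
Qed.

End BoundedOperators.

Record bounded_operator (R : realType) (H : hilbertType R) := BoundedOperator {
  bop_fun :> H -> H ;
  bop_funP : bop_fun \in bounded_linear_pred
}.

Notation "''B' ( H )" := (bounded_operator H) (format "''B' ( H )") : type_scope.

Section BoundedOperatorAlgebra.
Context {R : realType} {H : hilbertType R}.

HB.instance Definition _ := [isSub for @bop_fun R H].
HB.instance Definition _ := [Choice of 'B(H) by <:].
HB.instance Definition _ := [SubChoice_isSubZmodule of 'B(H) by <:].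
HB.instance Definition _ := [SubZmodule_isSubLmodule of 'B(H) by <:].

Implicit Types S T U : 'B(H).

Lemma bopP S T : (forall x, S x = T x) -> S = T.
Proof. by move=> e; apply/val_inj/funext. Qed.

Lemma bop_bounded_linear T : bounded_linear T.
Proof. exact/asboolP/(bop_funP T). Qed.

Definition bop_one : 'B(H) := BoundedOperator (asboolT (@bounded_linear_id R H)).

Definition bop_mul S T : 'B(H) := BoundedOperator (asboolT
  (bounded_linear_comp (bop_bounded_linear S) (bop_bounded_linear T))).

Lemma bop_addE S T x : (S + T) x = S x + T x. Proof. by []. Qed.

Lemma bop_scaleE (a : R[i]) T x : (a *: T) x = a *: T x. Proof. by []. Qed.

Lemma bop_mulA : associative bop_mul.
Proof. by move=> S T U; exact: bopP. Qed.

Lemma bop_mul1l : left_id bop_one bop_mul.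
Proof. by move=> S; exact: bopP. Qed.

Lemma bop_mul1r : right_id bop_one bop_mul.
Proof. by move=> S; exact: bopP. Qed.

Lemma bop_mulDl : left_distributive bop_mul +%R.
Proof. by move=> S T U; exact: bopP. Qed.

Lemma bop_mulDr : right_distributive bop_mul +%R.
Proof.
move=> S T U; apply: bopP => x /=.
have [lS _] := bop_bounded_linear S.
by have := lS 1 (T x) (U x); rewrite !scale1r.
Qed.

(* Only a [pzRingType]: 1 = 0 in 'B(H) when H is the zero space. *)
HB.instance Definition _ := GRing.Zmodule_isPzRing.Build 'B(H)
  bop_mulA bop_mul1l bop_mul1r bop_mulDl bop_mulDr.

(* Invertible in the algebra 'B(H), i.e. with a bounded two-sided inverse. *)
Definition bop_invertible T : Prop := exists S, S * T = 1 /\ T * S = 1.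

(* In [R[i]], [0 <= z] means that z is real and nonnegative. *)
Definition bop_positive T : Prop := forall x, 0 <= dotp (T x) x.

(* Existence and uniqueness hold in any Hilbert space (Riesz representation),
   so that the default value 0 of [xget] is never used. *)
Definition bop_adjoint T : 'B(H) :=
  xget 0 [set S : 'B(H) | forall x y, dotp (T x) y = dotp x (S y)].

(* The unique positive square root, meaningful for a positive T only. *)
Definition bop_sqrt T : 'B(H) :=
  xget 0 [set S : 'B(H) | bop_positive S /\ S ^+ 2 = T].

Definition bop_abs T : 'B(H) := bop_sqrt (bop_adjoint T * T).

End BoundedOperatorAlgebra.

(* Main.v *)
(* If A + B is bounded below then |x| <= K (|Ax| + |Bx|), and | |A|x | = |Ax|, so
   the pair (|A|, |B|) is bounded below in the same joint sense.  For positive P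
   and Q this joint bound is equivalent to coercivity of P + Q, because
   |Px|^2 <= M <Px,x>, and it also gives coercivity of P^2 + Q^2 because
   |Px|^2 = <P^2 x,x>; so it passes from (P, Q) to (P^2, Q^2), and coercive
   symmetric operators are invertible.  The same bound follows from invertibility
   of alpha A + beta B. *)

Require Import Defs.
From mathcomp Require Import all_boot all_order all_algebra.
From mathcomp Require Import all_classical all_reals all_analysis.
From mathcomp Require Import ring lra.

Import numFieldNormedType.Exports.
Local Open Scope ring_scope.
Local Open Scope complex_scope.

Set Implicit Arguments.
Unset Strict Implicit.
Unset Printing Implicit Defensive.

Import Order.TTheory GRing.Theory Num.Theory.

(** * Real part of the inner product and the norm as a real number *)

Section RealInnerProduct.
Context {R : realType} {H : hilbertType R}.
Implicit Types (x y z : H) (t : R).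

(** Keeps all estimates in the ordered field [R]; [Im_dotp] recovers the imaginary part. *)
Definition rdot x y : R := complex.Re (dotp x y).
Definition rnorm x : R := complex.Re `|x|.

Lemma rnormE x : (rnorm x)%:C = `|x|.
Proof. exact/RRe_real/normr_real. Qed.

Lemma rnorm_ge0 x : 0 <= rnorm x.
Proof. by rewrite -lecR rnormE normr_ge0. Qed.

Lemma rnormD x y : rnorm (x + y) <= rnorm x + rnorm y.
Proof. by rewrite -lecR rmorphD /= !rnormE ler_normD. Qed.

Lemma rnormN x : rnorm (- x) = rnorm x.
Proof. by rewrite /rnorm normrN. Qed.

Lemma rnormZ (a : R[i]) x : rnorm (a *: x) = complex.Re `|a| * rnorm x.
Proof.
by rewrite /rnorm normrZ -(RRe_real (normr_real a)) -[`|x|]rnormE -rmorphM.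
Qed.

Lemma rnorm_eq0 x : rnorm x = 0 -> x = 0.
Proof. by move=> x0; apply/normr0_eq0; rewrite -rnormE x0. Qed.

Lemma rnorm_sq x : rnorm x ^+ 2 = rdot x x.
Proof. by rewrite /rdot -dotp_norm -rnormE -rmorphXn. Qed.

Lemma rdotC x y : rdot x y = rdot y x.
Proof.
rewrite /rdot hermC expr0 mul1r.
by change (complex.Re (Num.conj (dotp y x)) = complex.Re (dotp y x)); case: (dotp y x).
Qed.

Lemma rdotDl x y z : rdot (x + y) z = rdot x z + rdot y z.
Proof. by rewrite /rdot linearDl raddfD. Qed.

Lemma rdotDr x y z : rdot x (y + z) = rdot x y + rdot x z.
Proof. by rewrite rdotC rdotDl !(rdotC x). Qed.

Lemma rdotNl x y : rdot (- x) y = - rdot x y.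
Proof. by rewrite /rdot linearNl raddfN. Qed.

Lemma rdotNr x y : rdot x (- y) = - rdot x y.
Proof. by rewrite rdotC rdotNl rdotC. Qed.

Lemma rdotZl t x y : rdot (t%:C *: x) y = t * rdot x y.
Proof.
rewrite /rdot linearZl_LR /=.
by case: (dotp x y) => a b /=; rewrite mul0r subr0.
Qed.

Lemma rdotZr t x y : rdot x (t%:C *: y) = t * rdot x y.
Proof. by rewrite rdotC rdotZl rdotC. Qed.

Lemma scaleii x : 'i%C *: ('i%C *: x) = - x.
Proof. by rewrite scalerA -expr2 sqr_i scaleN1r. Qed.

Lemma rdotii x y : rdot ('i%C *: x) ('i%C *: y) = rdot x y.
Proof.
rewrite /rdot linearZl_LR linearZr_LR /=.
by case: (dotp x y) => a b /=; ring.
Qed.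

Lemma Im_dotp x y : complex.Im (dotp x y) = rdot x ('i%C *: y).
Proof.
rewrite /rdot linearZr_LR /=.
by case: (dotp x y) => a b /=; ring.
Qed.

Lemma rdot_inj x y : (forall z, rdot x z = rdot y z) -> x = y.
Proof.
move=> xy; apply/eqP; rewrite -subr_eq0; apply/eqP/rnorm_eq0/eqP.
by rewrite -sqrf_eq0 rnorm_sq rdotDl rdotNl xy subrr.
Qed.

End RealInnerProduct.

Lemma discr_le0 (R : realFieldType) (a b c : R) :
  0 <= c -> (forall t, 0 <= a + 2 * t * b + t ^+ 2 * c) -> b ^+ 2 <= a * c.
Proof.
rewrite le_eqVlt => /predU1P[<- abc|c0 abc].
  have [->|b0] := eqVneq b 0; first by rewrite expr0n mulr0.
  (* For c = 0 the expression is affine in t, and this t gives it the value -1. *)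
  have := abc (- (a + 1) / (2 * b)).
  have -> : a + 2 * (- (a + 1) / (2 * b)) * b + (- (a + 1) / (2 * b)) ^+ 2 * 0 =
    - 1 by field.
  by rewrite oppr_ge0 ler10.
(* The minimizer of the quadratic. *)
have := abc (- b / c).
have -> : a + 2 * (- b / c) * b + (- b / c) ^+ 2 * c = (a * c - b ^+ 2) / c.
  by field; rewrite gt_eqF.
by rewrite pmulr_lge0 ?invr_gt0// subr_ge0.
Qed.

(** * Positive operators and the Cauchy-Schwarz inequality for their forms *)

Section Operators.
Context {R : realType} {H : hilbertType R}.
Implicit Types (x y : H) (T : 'B(H)).

Lemma bopD T x y : T (x + y) = T x + T y.
Proof. by have [lT _] := bop_bounded_linear T; have := lT 1 x y; rewrite !scale1r. Qed.

Lemma bop0 T : T 0 = 0.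
Proof. by apply: (addIr (T 0)); rewrite -bopD !add0r. Qed.

Lemma bopZ T (a : R[i]) x : T (a *: x) = a *: T x.
Proof. by have [lT _] := bop_bounded_linear T; have := lT a x 0; rewrite bop0 !addr0. Qed.

Lemma bopN T x : T (- x) = - T x.
Proof. by rewrite -scaleN1r bopZ scaleN1r. Qed.

Lemma bop_le T : exists2 M : R, 0 < M & forall x, rnorm (T x) <= M * rnorm x.
Proof.
have [M M0 TM] := bounded_linear_ge0 (bop_bounded_linear T).
(* The added 1 makes the bound strictly positive, so that it can be inverted later. *)
exists (M + 1) => [|x]; first by rewrite ltr_wpDl.
have : rnorm (T x) <= M * rnorm x by rewrite -lecR rmorphM /= !rnormE.
by move=> /le_trans; apply; rewrite ler_wpM2r ?rnorm_ge0// lerDl.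
Qed.

Definition symmetric_op T := forall x y, rdot (T x) y = rdot x (T y).

(** A nonnegative <Tz,z> is real, so Re <Tz,iz> = 0 for all z; taking z = x + iy gives symmetry.
    Conversely, symmetry makes Re <Tx,ix> equal to its own negative. *)
Lemma positive_opP T :
  bop_positive T <-> symmetric_op T /\ forall x, 0 <= rdot (T x) x.
Proof.
split=> [Tp|[Ts Tp] x].
  split=> [x y|x]; last by have := Tp x; rewrite lecE => /andP[].
  have T0 z : rdot (T z) ('i%C *: z) = 0.
    by have := Tp z; rewrite lecE -Im_dotp => /andP[/eqP].
  have := T0 (x + 'i%C *: y).
  rewrite !(bopD, bopZ, scalerDr, rdotDl, rdotDr) !T0 scaleii.
  rewrite rdotNr !rdotii.
  rewrite (_ : rdot ('i%C *: T y) (- y) = rdot (T y) ('i%C *: y)); last first.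
    by rewrite -scaleii rdotii.
  rewrite T0 (rdotC (T y)) => /eqP; rewrite addr0 add0r addrC subr_eq0.
  by move=> /eqP.
rewrite lecE Tp andbT /=; apply/eqP.
have e : rdot (T x) ('i%C *: x) = - rdot (T x) ('i%C *: x).
  by rewrite {1}Ts bopZ rdotC -[in RHS]rdotii scaleii rdotNr opprK.
by rewrite Im_dotp; lra.
Qed.

Lemma form_cauchy_schwarz T x y : bop_positive T ->
  rdot (T x) y ^+ 2 <= rdot (T x) x * rdot (T y) y.
Proof.
move=> /positive_opP[Ts Tp]; apply: discr_le0 => // t.
have := Tp (x + t%:C *: y).
rewrite bopD bopZ !(rdotDl, rdotDr) !(rdotZl, rdotZr) (Ts y) (rdotC y).
by congr (_ <= _); ring.
Qed.

Lemma positive1 : bop_positive (1 : 'B(H)).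
Proof. by apply/positive_opP; split=> // x; rewrite -rnorm_sq sqr_ge0. Qed.

Lemma rdot_le x y : `|rdot x y| <= rnorm x * rnorm y.
Proof.
rewrite -ler_sqr ?nnegrE ?normr_ge0 ?mulr_ge0 ?rnorm_ge0//.
rewrite real_normK ?num_real// exprMn !rnorm_sq.
exact: (form_cauchy_schwarz x y positive1).
Qed.

(** Cauchy-Schwarz for the form of T at y = Tx gives |Tx|^4 <= <Tx,x> <TTx,Tx> <= <Tx,x> M |Tx|^2;
    divide by |Tx|^2. *)
Lemma positive_norm_le T : bop_positive T ->
  exists2 M : R, 0 < M & forall x, rnorm (T x) ^+ 2 <= M * rdot (T x) x.
Proof.
move=> Tp; have [M M0 TM] := bop_le T; exists M => // x.
have [_ T0] := (positive_opP T).1 Tp.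
have := rnorm_ge0 (T x); rewrite le_eqVlt => /predU1P[<-|n0].
  by rewrite expr0n mulr_ge0// ltW.
rewrite -(ler_pM2r (exprn_gt0 2 n0)) -expr2 {1}rnorm_sq.
apply: (le_trans (form_cauchy_schwarz _ _ Tp)).
rewrite mulrAC mulrC ler_wpM2r//; apply: le_trans (ler_norm _) _.
by apply: le_trans (rdot_le _ _) _; rewrite expr2 mulrA ler_wpM2r ?rnorm_ge0.
Qed.

End Operators.

(** * Completeness, Riesz-type representation, inverses and adjoints *)

Section Completeness.
Context {R : realType} {H : hilbertType R}.
Implicit Types (x y z : H) (A T : 'B(H)).
Local Open Scope classical_set_scope.

Lemma hilbert_complete (u : nat -> H) (a : nat -> R) :
  a @ \oo --> 0 ->
  (forall n m, (n <= m)%N -> rnorm (u m - u n) <= a n) ->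
  exists z, forall n, rnorm (z - u n) <= a n.
Proof.
move=> a0 ua.
have ltC (v : H) (e : R[i]) : 0 < e -> rnorm v < complex.Re e -> `|v| < e.
  by move=> e0 ve; rewrite -rnormE -(RRe_real (gtr0_real e0)) ltcR.
have uC : cauchy (u @ \oo).
  apply: cauchy_exP => e e0.
  have e0' : 0 < complex.Re e by move: e0; rewrite ltcE => /andP[].
  have [n _ an] := (cvgrPdist_lt _ _).1 a0 _ e0'.
  exists (u n); exists n => // m /= nm.
  rewrite -ball_normE /=; apply: ltC => //.
  rewrite -rnormN opprB; apply: le_lt_trans (ua _ _ nm) _.
  by have := an _ (leqnn n); rewrite sub0r normrN; apply: le_lt_trans (ler_norm _).
have [z uz] : exists z, u @ \oo --> z by exists (lim (u @ \oo)); exact: cauchy_cvg.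
exists z => n; apply/ler_addgt0Pr => e e0.
have eC : 0 < e%:C by rewrite ltcR.
have [m _ um] := (cvgrPdist_lt _ _).1 uz _ eC.
have := um _ (leq_maxr n m); rewrite -rnormE ltcR /= => ze.
rewrite (_ : z - u n = (u (maxn n m) - u n) + (z - u (maxn n m))); last first.
  by rewrite [RHS]addrC addrA subrK.
apply: le_trans (rnormD _ _) _; apply: lerD; last exact: ltW.
by apply: ua; rewrite leq_maxl.
Qed.

(** Used to prove identities between limits: t is the norm of a difference, estimated at every stage
    n. *)
Lemma le0_cvg0 (a : nat -> R) (k t : R) :
  a @ \oo --> 0 -> (forall n, t <= k * a n) -> t <= 0.
Proof.
move=> a0 ta; have ka : (fun n => k * a n) @ \oo --> 0.
  by rewrite -[0 in X in _ --> X](mulr0 k); apply: cvgMr.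
by rewrite -(cvg_lim (@Rhausdorff R) ka); apply: limr_ge; [exact: cvgP ka|exact: nearW].
Qed.

Lemma bop_complete (Y : nat -> 'B(H)) (a : nat -> R) :
  a @ \oo --> 0 ->
  (forall n m x, (n <= m)%N -> rnorm (Y m x - Y n x) <= a n * rnorm x) ->
  exists Z : 'B(H), forall n x, rnorm (Z x - Y n x) <= a n * rnorm x.
Proof.
move=> a0 Ya.
have /choice[Z Zlim] x : exists z, forall n, rnorm (z - Y n x) <= a n * rnorm x.
  apply: hilbert_complete => [|n m nm]; last exact: Ya.
  by rewrite -[0 in X in _ --> X](mul0r (rnorm x)); apply: cvgMl.
have Zl : linear Z.
  move=> b x y; apply/eqP; rewrite -subr_eq0; apply/eqP/rnorm_eq0/le_anti.
  rewrite rnorm_ge0 andbT.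
  apply: (@le0_cvg0 a (rnorm (b *: x + y) + complex.Re `|b| * rnorm x + rnorm y)) => // n.
  have -> : Z (b *: x + y) - (b *: Z x + Z y) =
      (Z (b *: x + y) - Y n (b *: x + y)) +
      ((- b) *: (Z x - Y n x) + - (Z y - Y n y)).
    by rewrite bopD bopZ scaleNr scalerBr -opprD addrACA -opprD opprB addrA subrK.
  apply: le_trans (rnormD _ _) _; rewrite !mulrDl -addrA lerD//.
    by rewrite mulrC.
  apply: le_trans (rnormD _ _) _; rewrite rnormZ rnormN normrN lerD//.
    rewrite -mulrA [rnorm x * _]mulrC ler_wpM2l//.
    by rewrite -lecR (RRe_real (normr_real b)) normr_ge0.
  by rewrite mulrC.
have [M M0 YM] := bop_le (Y 0%N).
have Zb : bounded_linear Z.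
  split=> //; exists (a 0%N + M) => x.
  rewrite -!rnormE -rmorphM lecR -[Z x](subrK (Y 0%N x)).
  by apply: le_trans (rnormD _ _) _; rewrite mulrDl lerD.
by exists (BoundedOperator (asboolT Zb)).
Qed.

Definition coercive T := exists2 c : R, 0 < c &
  forall x, c * rnorm x ^+ 2 <= rdot (T x) x.

(* Along a minimizing sequence of x |-> <Tx,x> - 2 Re <y,Ax>, the parallelogram
   identity for the form of T gives convergence, and a discriminant bound shows
   that the derivative at the limit vanishes. *)
Lemma coercive_represents T A y : symmetric_op T -> coercive T ->
  exists z, forall h, rdot (T z) h = rdot y (A h).
Proof.
move=> Ts [c c0 Tc].
pose J x := rdot (T x) x - 2 * rdot y (A x).
have [M M0 AM] := bop_le A.
(* The coefficient of 2t is half the derivative of [J] at x along h, which has to vanish at the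
   minimizer. *)
have JD x h t : J (x + t%:C *: h) =
    J x + 2 * t * (rdot (T x) h - rdot y (A h)) + t ^+ 2 * rdot (T h) h.
  rewrite /J !(bopD, bopZ, rdotDl, rdotDr, rdotZl, rdotZr) (Ts h) (rdotC h).
  ring.
pose E := [set J x | x in [set: H]].
have Elb : has_inf E.
  split; first by exists (J 0), 0.
  (* The minimum over s of c s^2 - 2 |y| M s, a lower bound of [J] with s = |x|. *)
  exists (- (rnorm y * M) ^+ 2 / c) => _ [x _ <-]; rewrite /J.
  have := Tc x; have := rdot_le y (A x); have := AM x.
  have := rnorm_ge0 y; have := rnorm_ge0 x.
  move: (rnorm x) (rnorm y) (rnorm (A x)) (rdot y (A x)) (rdot (T x) x) => s r w p q.
  move=> s0 r0 ws pr qs.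
  have ps : p <= r * M * s.
    apply: le_trans (ler_norm _) _; apply: le_trans pr _.
    by rewrite -mulrA ler_wpM2l.
  have : 0 <= c * (s - r * M / c) ^+ 2 by rewrite mulr_ge0 ?sqr_ge0 ?ltW.
  have -> : c * (s - r * M / c) ^+ 2 = c * s ^+ 2 - 2 * (r * M * s) + (r * M) ^+ 2 / c.
    by field; rewrite gt_eqF.
  rewrite mulNr; lra.
pose d := inf E.
have Jd x : d <= J x by apply: ge_inf; [exact: Elb.2|exists x].
(* The factor c cancels against coercivity, so the midpoint estimate gives the Cauchy rate
   2/(n+1). *)
have /choice[u ud] n : exists x, J x <= d + c * n.+1%:R^-1 ^+ 2.
  have [] := @inf_adherent _ E (c * n.+1%:R^-1 ^+ 2) _ Elb.
    by rewrite mulr_gt0 ?exprn_gt0 ?invr_gt0 ?ltr0n.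
  by move=> _ [x _ <-] /ltW; exists x.
have h0 : (fun n => 2 * n.+1%:R^-1 : R) @ \oo --> 0.
  by rewrite -[0 in X in _ --> X](mulr0 2); apply: cvgMr; exact: cvg_harmonic.
have [n m nm|z uz] := @hilbert_complete u _ h0.
  rewrite -ler_sqr ?nnegrE ?rnorm_ge0 ?mulr_ge0 ?invr_ge0//.
  rewrite -(ler_pM2l c0); apply: le_trans (Tc _) _.
  have J4 : rdot (T (u m - u n)) (u m - u n) =
      2 * J (u m) + 2 * J (u n) - 4 * J (u n + 2^-1%:C *: (u m - u n)).
    rewrite JD /J !(bopD, bopN, rdotDl, rdotDr, rdotNl, rdotNr) (Ts (u n)) (rdotC (u n)).
    by field.
  rewrite J4.
  have := Jd (u n + 2^-1%:C *: (u m - u n)); have := ud m; have := ud n.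
  have : (m.+1%:R^-1 : R) ^+ 2 <= n.+1%:R^-1 ^+ 2.
    by rewrite ler_sqr ?nnegrE ?invr_ge0// lef_pV2 ?posrE ?ltr0n// ler_nat.
  move=> /(ler_wpM2l (ltW c0)).
  rewrite exprMn; move: (c * m.+1%:R^-1 ^+ 2) => r.
  have -> : c * (2 ^+ 2 * n.+1%:R^-1 ^+ 2) = 4 * (c * n.+1%:R^-1 ^+ 2) :> R by ring.
  move: (c * _) (J _) (J _) (J _) => e1 e2 e3 e4.
  lra.
exists z => h; apply/eqP; rewrite -subr_eq0 -normr_le0.
have [N N0 TN] := bop_le T.
pose q := rdot (T h) h.
have q0 : 0 <= q by apply: le_trans (Tc h); rewrite mulr_ge0 ?sqr_ge0 ?ltW.
apply: (@le0_cvg0 (fun n => 2 * n.+1%:R^-1 : R) (N * rnorm h + Num.sqrt (c * q))) => // n.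
(* Moving from [u n] along h lowers [J] by at most c/(n+1)^2, so a quadratic in t is nonnegative and
   [discr_le0] bounds its linear coefficient. *)
have un : `|rdot (T (u n)) h - rdot y (A h)| <= Num.sqrt (c * q) * n.+1%:R^-1.
  rewrite -ler_sqr ?nnegrE ?normr_ge0 ?mulr_ge0 ?sqrtr_ge0 ?invr_ge0//.
  rewrite real_normK ?num_real// exprMn sqr_sqrtr ?mulr_ge0 ?(ltW c0)//.
  rewrite mulrAC; apply: discr_le0 => // t.
  have := Jd (u n + t%:C *: h); rewrite JD -/q; have := ud n.
  by move: (J _) (c * _) (rdot _ _ - _) => e1 e2 e3; lra.
have -> : rdot (T z) h - rdot y (A h) =
    rdot (T (z - u n)) h + (rdot (T (u n)) h - rdot y (A h)).
  by rewrite bopD bopN rdotDl rdotNl addrA subrK.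
apply: le_trans (ler_normD _ _) _; rewrite mulrDl lerD//.
  apply: le_trans (rdot_le _ _) _.
  rewrite mulrAC ler_wpM2r ?rnorm_ge0//.
  by apply: le_trans (TN _) _; rewrite ler_wpM2l// ltW.
apply: le_trans un _; rewrite mulrCA ler_peMl ?mulr_ge0 ?sqrtr_ge0 ?invr_ge0//.
by rewrite ler1n.
Qed.

(** Representation with [A := 1] solves Tz = y. The lower bound c|x| <= |Tx| gives uniqueness and
    bounds the inverse by 1/c. *)
Lemma coercive_invertible T : symmetric_op T -> coercive T -> bop_invertible T.
Proof.
move=> Ts Tc; have [c c0 cT] := Tc.
have /choice[S TS] y : exists z, T z = y.
  have [z Tz] := coercive_represents 1 y Ts Tc.
  by exists z; apply: rdot_inj => h; rewrite Tz.
have Tlow x : c * rnorm x <= rnorm (T x).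
  have := rnorm_ge0 x; rewrite le_eqVlt => /predU1P[<-|x0].
    by rewrite mulr0 rnorm_ge0.
  rewrite -(ler_pM2r x0) -mulrA -expr2; apply: le_trans (cT x) _.
  exact: le_trans (ler_norm _) (rdot_le _ _).
have Tinj x y : T x = T y -> x = y.
  move=> Txy; apply/eqP; rewrite -subr_eq0; apply/eqP/rnorm_eq0/le_anti.
  rewrite rnorm_ge0 andbT -(pmulr_rle0 _ c0); apply: le_trans (Tlow _) _.
  by rewrite bopD bopN Txy subrr /rnorm normr0.
have Sb : bounded_linear S.
  split=> [a x y|]; first by apply: Tinj; rewrite bopD bopZ !TS.
  exists c^-1 => x; rewrite -!rnormE -rmorphM lecR -(ler_pM2l c0) mulrA.
  by rewrite mulfV ?gt_eqF// mul1r -{2}(TS x).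
exists (BoundedOperator (asboolT Sb)); split; apply: bopP => x /=; last exact: TS.
by apply: Tinj; rewrite TS.
Qed.

Lemma bop_adjointP T x y : dotp (T x) y = dotp x (bop_adjoint T y).
Proof.
(* The imaginary parts agree as well, by replacing v with iv and using complex linearity of S. *)
have rdot_dotp (S : 'B(H)) : (forall u v, rdot (T u) v = rdot u (S v)) ->
    forall u v, dotp (T u) v = dotp u (S v).
  move=> TS u v; apply/eqP; rewrite eq_complex !Im_dotp -bopZ.
  by rewrite -/(rdot _ _) -/(rdot u (S v)) !TS !eqxx.
suff [S TS] : exists S : 'B(H), forall u v, rdot (T u) v = rdot u (S v).
  have : exists S : 'B(H), forall u v, dotp (T u) v = dotp u (S v).
    by exists S; exact: rdot_dotp.
  by rewrite /bop_adjoint; case: xgetP => [S' _ /= ->//|] + [S' TS'] => /(_ S').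
have c1 : coercive (1 : 'B(H)) by exists 1 => // u; rewrite mul1r rnorm_sq.
have [s1 _] := (positive_opP 1).1 (@positive1 R H).
(* Applied to the identity form, [coercive_represents] is the Riesz theorem for the functional u |->
   Re <v,Tu>. *)
have /choice[S TS] v : exists z, forall u, rdot z u = rdot v (T u).
  by have [z] := coercive_represents T v s1 c1; exists z.
have [M M0 TM] := bop_le T.
have Sb : bounded_linear S.
  split=> [a u v|].
    apply: rdot_inj => w.
    have rZ (b : R[i]) (p q : H) : rdot (b *: p) q = rdot p (b^*%C *: q).
      by rewrite /rdot linearZl_LR linearZr_LR /= conjCK.
    by rewrite rdotDl rZ !TS bopZ rdotDl rZ.
  exists M => v; rewrite -!rnormE -rmorphM lecR.
  have := rnorm_ge0 (S v); rewrite le_eqVlt => /predU1P[<-|n0].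
    by rewrite mulr_ge0 ?rnorm_ge0 ?ltW.
  rewrite -(ler_pM2r n0) -expr2 rnorm_sq TS; apply: le_trans (ler_norm _) _.
  apply: le_trans (rdot_le _ _) _; rewrite mulrC mulrAC ler_wpM2r ?rnorm_ge0//.
by exists (BoundedOperator (asboolT Sb)) => u v; rewrite (rdotC u) /= TS rdotC.
Qed.

End Completeness.

(** * Positive square roots and the absolute value *)

Section SquareRoot.
Context {R : realType} {H : hilbertType R}.
Implicit Types (x : H) (C T : 'B(H)).

(* The iteration Y(n+1) = (C + Y(n)^2) / 2 is dominated by the same scalar
   iteration started with C = 1, whose limit is 1. *)
Lemma sqrt_one_sub C : symmetric_op C -> (forall x, rnorm (C x) <= rnorm x) ->
  exists2 S : 'B(H), bop_positive S & forall x, S (S x) = x - C x.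
Proof.
move=> Cs C1.
(* A fixed point satisfies 2Z = C + Z^2, that is (1 - Z)^2 = 1 - C. *)
pose Y n := iter n (fun Z : 'B(H) => (2^-1)%:C *: (C + Z * Z)) 0.
pose y n : R := iter n (fun t => (1 + t ^+ 2) / 2) 0.
have YS n x : Y n.+1 x = (2^-1)%:C *: (C x + Y n (Y n x)) by [].
have yS n : y n.+1 = (1 + y n ^+ 2) / 2 by [].
have halfE v : rnorm ((2^-1)%:C *: v : H) = 2^-1 * rnorm v.
  by rewrite rnormZ ger0_norm// lecR.
have y01 n : 0 <= y n /\ y n <= 1.
  elim: n => [|n [y0 y1]]; first by rewrite /y /= ler01.
  rewrite yS; have : y n ^+ 2 <= 1 by rewrite expr_le1.
  by have := sqr_ge0 (y n); move: (y n ^+ 2) => s; split; lra.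
(* The gap e = 1 - [y n] evolves by e |-> e - e^2/2, increasing on [0,1], which sends 2/t below
   2/(t+1). The shift to n+2 makes n = 0 an equality. *)
have ylim n : 1 - y n <= 2 * n.+2%:R^-1.
  elim: n => [|n IH]; first by rewrite /y /= subr0 mulfV.
  have [y0 y1] := y01 n.
  pose t : R := n.+2%:R; have t0 : 0 < t by rewrite ltr0n.
  have -> : 1 - y n.+1 = (1 - y n) - (1 - y n) ^+ 2 / 2 by rewrite yS; field.
  have tinv : t^-1 <= 2^-1 by rewrite lef_pV2 ?posrE ?ler_nat.
  have le1 : (1 - y n) - (1 - y n) ^+ 2 / 2 <= 2 * t^-1 - (2 * t^-1) ^+ 2 / 2.
    move: IH; rewrite -/t; move: (t^-1) tinv (y n) y0 y1 => r r2 s s0 s1 sr.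
    have : 0 <= (2 * r - (1 - s)) * (2 - 2 * r - (1 - s)) by apply: mulr_ge0; lra.
    lra.
  apply: le_trans le1 _.
  have -> : n.+3%:R = t + 1 :> R by rewrite /t -natr1.
  have t1 : 0 < t + 1 by rewrite addr_gt0.
  rewrite -subr_ge0.
  have -> : 2 * (t + 1)^-1 - (2 * t^-1 - (2 * t^-1) ^+ 2 / 2) =
      2 / (t ^+ 2 * (t + 1)).
    by field; rewrite !gt_eqF.
  by rewrite divr_ge0 ?mulr_ge0 ?exprn_ge0 ?ltW.
have Yy n x : rnorm (Y n x) <= y n * rnorm x.
  elim: n x => [|n IH] x; first by rewrite mul0r /rnorm normr0.
  have [y0 _] := y01 n.
  rewrite YS yS halfE mulrAC [leRHS]mulrC ler_wpM2l ?invr_ge0//.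
  apply: le_trans (rnormD _ _) _; rewrite mulrDl mul1r lerD//.
  by apply: le_trans (IH _) _; rewrite expr2 -mulrA ler_wpM2l.
have stepY n x : rnorm (Y n.+1 x - Y n x) <= (y n.+1 - y n) * rnorm x.
  elim: n x => [|n IH] x.
    have Y0 v : Y 0%N v = 0 by [].
    have -> : y 1%N - y 0%N = 2^-1 by rewrite /y /= expr0n addr0 subr0 mul1r.
    rewrite YS !Y0 subr0 addr0 halfE.
    by rewrite ler_wpM2l ?invr_ge0.
  rewrite YS [in X in _ - X]YS -scalerBr halfE.
  (* The difference of squares is split in the same way as its scalar counterpart below, so the
     bounds match term by term. *)
  have -> : C x + Y n.+1 (Y n.+1 x) - (C x + Y n (Y n x)) =
      Y n.+1 (Y n.+1 x - Y n x) + (Y n.+1 (Y n x) - Y n (Y n x)).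
    by rewrite bopD bopN addrA subrK opprD addrACA subrr add0r.
  rewrite (yS n.+1) {2}(yS n).
  have -> : (1 + y n.+1 ^+ 2) / 2 - (1 + y n ^+ 2) / 2 =
      2^-1 * (y n.+1 * (y n.+1 - y n) + (y n.+1 - y n) * y n) by field.
  rewrite -mulrA ler_wpM2l ?invr_ge0//.
  apply: le_trans (rnormD _ _) _; rewrite mulrDl lerD//.
    by apply: le_trans (Yy _ _) _; rewrite -mulrA ler_wpM2l//; have [] := y01 n.+1.
  have [y0 y1] := y01 n; apply: le_trans (IH _) _; rewrite -mulrA ler_wpM2l//.
  rewrite subr_ge0 yS; have := sqr_ge0 (1 - y n); lra.
have Yya n m x : (n <= m)%N -> rnorm (Y m x - Y n x) <= 2 * n.+1%:R^-1 * rnorm x.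
  move=> nm; have [_ ym1] := y01 m.
  apply: (@le_trans _ _ ((y m - y n) * rnorm x)); last first.
    rewrite ler_wpM2r ?rnorm_ge0//; apply: le_trans (_ : _ <= 1 - y n) _.
      by rewrite lerD2r.
    apply: le_trans (ylim n) _.
    by rewrite ler_wpM2l// lef_pV2 ?posrE ?ltr0n// ler_nat.
  (* The step bounds telescope to [y m - y n]. *)
  rewrite -(subnK nm) addnC; elim: (m - n)%N => [|k IH].
    by rewrite addn0 !subrr mul0r /rnorm normr0.
  rewrite addnS -[Y (n + k).+1 x](subrK (Y (n + k)%N x)) -addrA.
  apply: le_trans (rnormD _ _) _.
  rewrite -[y (n + k).+1](subrK (y (n + k)%N)) -addrA mulrDl lerD//.
pose a n : R := 2 * n.+1%:R^-1.
have a0 : (a @ \oo --> (0 : R))%classic.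
  by rewrite -[0 in X in (_ --> X)%classic](mulr0 2); apply: cvgMr; exact: cvg_harmonic.
have [Z ZY] := bop_complete a0 Yya.
have Ys n : symmetric_op (Y n).
  elim: n => [|n IH] u v.
    by rewrite /rdot linear0l linear0r.
  by rewrite !YS !(rdotZl, rdotZr, rdotDl, rdotDr) Cs !IH.
have Zs : symmetric_op Z.
  move=> u v; apply/eqP; rewrite -subr_eq0 -normr_le0.
  apply: (@le0_cvg0 _ a (2 * (rnorm u * rnorm v))) => // n.
  have -> : rdot (Z u) v - rdot u (Z v) =
      rdot (Z u - Y n u) v - rdot u (Z v - Y n v).
    by rewrite rdotDl rdotDr rdotNl rdotNr Ys; ring.
  apply: le_trans (ler_normB _ _) _.
  have -> : 2 * (rnorm u * rnorm v) * a n =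
    a n * rnorm u * rnorm v + rnorm u * (a n * rnorm v) by ring.
  apply: lerD; apply: le_trans (rdot_le _ _) _.
    by rewrite ler_wpM2r ?rnorm_ge0.
  by rewrite ler_wpM2l ?rnorm_ge0.
have Z1 x : rnorm (Z x) <= rnorm x.
  rewrite -subr_le0; apply: (@le0_cvg0 _ a (rnorm x)) => // n.
  rewrite lerBlDr -[Z x](subrK (Y n x)); apply: le_trans (rnormD _ _) _.
  apply: lerD; first by rewrite mulrC.
  apply: le_trans (Yy n x) _; rewrite ler_piMl ?rnorm_ge0//.
  by have [] := y01 n.
have ZZ x : Z x + Z x = C x + Z (Z x).
  apply/eqP; rewrite -subr_eq0; apply/eqP/rnorm_eq0/le_anti.
  (* Four errors of size at most a(n)|x|: two copies of Zx - Y(n+1)x, then Z(Zx - Y(n)x), then (Z -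
     Y(n)) at Y(n)x. *)
  rewrite rnorm_ge0 andbT; apply: (@le0_cvg0 _ a (4 * rnorm x)) => // n.
  have YY : Y n.+1 x + Y n.+1 x = C x + Y n (Y n x).
    rewrite YS -scalerDl -rmorphD /= (_ : 2^-1 + 2^-1 = 1 :> R) ?scale1r//.
    by field.
  have -> : Z x + Z x - (C x + Z (Z x)) =
      (Z x - Y n.+1 x) + (Z x - Y n.+1 x) -
      (Z (Z x - Y n x) + (Z (Y n x) - Y n (Y n x))).
    rewrite (_ : Z (Z x - Y n x) + _ = Z (Z x) - Y n (Y n x)); last first.
      by rewrite bopD bopN addrA subrK.
    rewrite [in RHS]addrACA -opprD YY !opprD opprK -[RHS]addrA; congr (_ + _).
    by rewrite addrACA addNr addr0.
  have aS : a n.+1 <= a n.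
    by rewrite /a ler_wpM2l// lef_pV2 ?posrE ?ltr0n// ler_nat.
  have ZYS : rnorm (Z x - Y n.+1 x) <= a n * rnorm x.
    by apply: le_trans (ZY _ _) _; rewrite ler_wpM2r ?rnorm_ge0.
  have -> : 4 * rnorm x * a n = (a n * rnorm x + a n * rnorm x) +
    (a n * rnorm x + a n * rnorm x) by ring.
  apply: le_trans (rnormD _ _) _; apply: lerD.
    by apply: le_trans (rnormD _ _) _; apply: lerD.
  rewrite rnormN; apply: le_trans (rnormD _ _) _; apply: lerD.
    exact: le_trans (Z1 _) _.
  apply: le_trans (ZY _ _) _; rewrite ler_wpM2l ?mulr_ge0 ?invr_ge0//.
  apply: le_trans (Yy n x) _; rewrite ler_piMl ?rnorm_ge0//.
  by have [] := y01 n.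
exists (1 - Z).
  apply/positive_opP; split=> [u v|u].
    by rewrite !(rdotDl, rdotDr) !(rdotNl, rdotNr) Zs.
  change (0 <= rdot (u - Z u) u).
  rewrite rdotDl rdotNl subr_ge0 -rnorm_sq; apply: le_trans (ler_norm _) _.
  by apply: le_trans (rdot_le _ _) _; rewrite expr2 ler_wpM2r ?rnorm_ge0.
move=> x; change (x - Z x - Z (x - Z x) = x - C x).
by rewrite bopD bopN opprB addrACA -opprD ZZ opprD addrACA subrr addr0.
Qed.

Lemma positive_sqrt T : bop_positive T ->
  exists2 S : 'B(H), bop_positive S & S ^+ 2 = T.
Proof.
move=> Tp; have [Ts T0] := (positive_opP T).1 Tp.
have [M M0 TM] := positive_norm_le Tp.
(* A contraction: |Cx|^2 = |x|^2 - 2<Tx,x>/M + |Tx|^2/M^2, and |Tx|^2 <= M<Tx,x>. The root of 1 - C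
   = T/M is then scaled by sqrt M. *)
pose C : 'B(H) := 1 - (M^-1)%:C *: T.
have CE x : C x = x - (M^-1)%:C *: T x by [].
have [u v|x|S Sp SS] := @sqrt_one_sub C.
- by rewrite !CE !(rdotDl, rdotDr, rdotNl, rdotNr, rdotZl, rdotZr) Ts.
- rewrite -ler_sqr ?nnegrE ?rnorm_ge0// !rnorm_sq CE.
  rewrite !(rdotDl, rdotDr, rdotNl, rdotNr, rdotZl, rdotZr) -!rnorm_sq -(Ts x).
  have := TM x; have := T0 x.
  move: (rdot (T x) x) (rnorm (T x) ^+ 2) => s r s0 rs.
  have : M^-1 * (M^-1 * r) <= M^-1 * s.
    by rewrite ler_wpM2l ?invr_ge0 ?(ltW M0)// ler_pdivrMl.
  have : 0 <= M^-1 * s by rewrite mulr_ge0// invr_ge0 ltW.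
  lra.
have [Ss S0] := (positive_opP S).1 Sp.
exists ((Num.sqrt M)%:C *: S).
  apply/positive_opP; split=> [u v|u]; first by rewrite rdotZl rdotZr Ss.
  by rewrite rdotZl mulr_ge0 ?sqrtr_ge0 //; exact: S0.
apply: bopP => x; rewrite expr2.
change ((Num.sqrt M)%:C *: S ((Num.sqrt M)%:C *: S x) = T x).
rewrite bopZ scalerA -rmorphM /= -expr2 sqr_sqrtr ?(ltW M0)// SS CE opprB addrC subrK.
by rewrite scalerA -rmorphM /= mulfV ?gt_eqF// scale1r.
Qed.

Lemma bop_sqrtP T : bop_positive T ->
  bop_positive (bop_sqrt T) /\ bop_sqrt T ^+ 2 = T.
Proof.
move=> Tp; have [S Sp ST] := positive_sqrt Tp.
by rewrite /bop_sqrt; case: xgetP => [S' _ //|/(_ S)]; case.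
Qed.

(** The norms agree because | |T|x |^2 = <|T|^2 x,x> = <T*Tx,x> = |Tx|^2. Through these two facts
    |T| enters the theorem. *)
Lemma bop_absP T :
  bop_positive (bop_abs T) /\ forall x, rnorm (bop_abs T x) = rnorm (T x).
Proof.
have TTE x y : dotp ((bop_adjoint T * T) x) y = dotp (T x) (T y).
  change (dotp (bop_adjoint T (T x)) y = dotp (T x) (T y)).
  rewrite hermC [RHS]hermC; congr (_ * Num.conj _); exact/esym/bop_adjointP.
have TTp : bop_positive (bop_adjoint T * T).
  by move=> x; rewrite TTE -dotp_norm exprn_ge0.
have [Ap A2] := bop_sqrtP TTp; split=> // x.
have [As _] := (positive_opP _).1 Ap.
apply/eqP; rewrite -(@eqrXn2 _ 2) ?rnorm_ge0// !rnorm_sq /bop_abs -As.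
rewrite -[bop_sqrt _ (_ x)]/((bop_sqrt _ * bop_sqrt _) x) -expr2 A2.
by rewrite /rdot TTE.
Qed.

End SquareRoot.

(** * Joint lower bounds for pairs of operators *)

Section SumsOfPositive.
Context {R : realType} {H : hilbertType R}.
Implicit Types (x : H) (A B P Q : 'B(H)).

(** Says that the column operator x |-> (Ax, Bx) into the direct sum of two copies of H is bounded
    below. *)
Definition jointly_bounded_below A B := exists2 c : R, 0 < c &
  forall x, c * rnorm x <= rnorm (A x) + rnorm (B x).

Lemma positiveD P Q : bop_positive P -> bop_positive Q -> bop_positive (P + Q).
Proof.
move=> Pp Qp x; rewrite bop_addE linearDl.
by apply: addr_ge0; [exact: Pp|exact: Qp].
Qed.

Lemma positive_sqr P : bop_positive P -> bop_positive (P ^+ 2).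
Proof.
move=> /positive_opP[Ps _]; rewrite expr2; apply/positive_opP.
split=> [x y|x] /=; first by rewrite !Ps.
by rewrite Ps -rnorm_sq sqr_ge0.
Qed.

Lemma positive_exp2 P n : bop_positive P -> bop_positive (P ^+ (2 ^ n)).
Proof.
move=> Pp; elim: n => [|n IH]; first by rewrite expn0 expr1.
by rewrite expnSr exprM; exact: positive_sqr.
Qed.

Lemma invertible_bounded_below A B (a b : R[i]) :
  bop_invertible (a *: A + b *: B) -> jointly_bounded_below A B.
Proof.
move=> [S [ST _]]; have [M M0 SM] := bop_le S.
have na0 (z : R[i]) : 0 <= complex.Re `|z|.
  by rewrite -lecR (RRe_real (normr_real z)) normr_ge0.
(* Dominates both |a| and |b|, and stays positive when both scalars vanish. *)
pose K := 1 + complex.Re `|a| + complex.Re `|b|.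
have K0 : 0 < K by rewrite /K; have := na0 a; have := na0 b; lra.
exists (M * K)^-1 => [|x]; first by rewrite invr_gt0 mulr_gt0.
rewrite ler_pdivrMl ?mulr_gt0//.
have {1}-> : x = S (a *: A x + b *: B x).
  by rewrite -[LHS]/((1 : 'B(H)) x) -ST.
apply: le_trans (SM _) _; rewrite -mulrA ler_wpM2l ?(ltW M0)//.
apply: le_trans (rnormD _ _) _; rewrite !rnormZ mulrDr.
by apply: lerD; rewrite ler_wpM2r ?rnorm_ge0// /K; have := na0 a; have := na0 b; lra.
Qed.

(* For positive P one has |P x|^2 <= M <P x, x>, by Cauchy-Schwarz for the form of P. *)
Lemma bounded_below_coercive P Q : bop_positive P -> bop_positive Q ->
  jointly_bounded_below P Q -> coercive (P + Q).
Proof.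
move=> Pp Qp [c c0 cPQ].
have [M M0 PM] := positive_norm_le Pp; have [N N0 QN] := positive_norm_le Qp.
have [[_ P0] [_ Q0]] := ((positive_opP P).1 Pp, (positive_opP Q).1 Qp).
(* From (p + q)^2 <= 2(p^2 + q^2) <= 2(Mr + Ns) <= 2(M + N)(r + s), where p = |Px|, q = |Qx|, r =
   <Px,x>, s = <Qx,x>. *)
exists (c ^+ 2 / (2 * (M + N))) => [|x].
  by rewrite divr_gt0 ?exprn_gt0// mulr_gt0// addr_gt0.
rewrite mulrAC ler_pdivrMr ?mulr_gt0 ?addr_gt0// -exprMn.
have := cPQ x; rewrite -ler_sqr ?nnegrE ?addr_ge0 ?mulr_ge0 ?rnorm_ge0 ?(ltW c0)//.
move=> /le_trans; apply; rewrite bop_addE rdotDl.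
have := PM x; have := QN x; have := P0 x; have := Q0 x.
have := sqr_ge0 (rnorm (P x) - rnorm (Q x)).
move: (rnorm (P x)) (rnorm (Q x)) (rdot _ _) (rdot _ _) => p q s r pq r0 s0 qs pr.
have : 0 <= N * s by rewrite mulr_ge0 ?(ltW N0).
have : 0 <= M * r by rewrite mulr_ge0 ?(ltW M0).
lra.
Qed.

(** Cauchy-Schwarz: c|x|^2 <= <(P+Q)x,x> <= (|Px| + |Qx|)|x|; divide by |x|. *)
Lemma coercive_bounded_below P Q : coercive (P + Q) -> jointly_bounded_below P Q.
Proof.
move=> [c c0 cPQ]; exists c => // x.
have := rnorm_ge0 x; rewrite le_eqVlt => /predU1P[<-|x0].
  by rewrite mulr0 addr_ge0 ?rnorm_ge0.
rewrite -(ler_pM2r x0) -mulrA -expr2; apply: le_trans (cPQ x) _.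
apply: le_trans (ler_norm _) _; apply: le_trans (rdot_le _ _) _.
by rewrite ler_wpM2r ?rnorm_ge0// rnormD.
Qed.

Lemma bounded_below_sqr P Q : bop_positive P -> bop_positive Q ->
  jointly_bounded_below P Q -> coercive (P ^+ 2 + Q ^+ 2).
Proof.
move=> /positive_opP[Ps _] /positive_opP[Qs _] [c c0 cPQ].
exists (c ^+ 2 / 2) => [|x]; first by rewrite divr_gt0 ?exprn_gt0.
rewrite mulrAC ler_pdivrMr// -exprMn.
have := cPQ x; rewrite -ler_sqr ?nnegrE ?addr_ge0 ?mulr_ge0 ?rnorm_ge0 ?(ltW c0)//.
move=> /le_trans; apply; rewrite bop_addE rdotDl !expr2 /= Ps Qs -!rnorm_sq.
have := sqr_ge0 (rnorm (P x) - rnorm (Q x)); lra.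
Qed.

(** Each squaring gives coercivity of the sum, hence again a joint bound; so the exponent doubles at
    every step. *)
Lemma bounded_below_exp2 P Q n : bop_positive P -> bop_positive Q ->
  jointly_bounded_below P Q ->
  jointly_bounded_below (P ^+ (2 ^ n)) (Q ^+ (2 ^ n)).
Proof.
move=> Pp Qp PQ; elim: n => [|n IH]; first by rewrite expn0 !expr1.
rewrite expnSr !exprM; apply: coercive_bounded_below.
by apply: bounded_below_sqr => //; exact: positive_exp2.
Qed.

Lemma positiveD_invertible P Q : bop_positive P -> bop_positive Q ->
  jointly_bounded_below P Q -> bop_invertible (P + Q).
Proof.
move=> Pp Qp PQ; apply: coercive_invertible; last exact: bounded_below_coercive.
by have [] := (positive_opP _).1 (positiveD Pp Qp).
Qed.

End SumsOfPositive.

Theorem theorem2p1 (R : realType) (H : hilbertType R) (A B : 'B(H)) :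
  (bop_invertible (A + B) ->
     bop_invertible (bop_abs A ^+ 2 + bop_abs B ^+ 2))
  /\
  (bop_invertible (A + B) ->
     bop_invertible (bop_abs A + bop_abs B) /\
     forall n : nat,
       bop_invertible (bop_abs A ^+ (2 ^ n) + bop_abs B ^+ (2 ^ n)))
  /\
  (bop_positive A -> bop_positive B ->
     forall alpha beta : R[i],
       bop_invertible (alpha *: A + beta *: B) -> bop_invertible (A + B)).
Proof.
have [[Ap nA] [Bp nB]] := (bop_absP A, bop_absP B).
have bounded_below_abs : bop_invertible (A + B) ->
    jointly_bounded_below (bop_abs A) (bop_abs B).
  move=> AB; have [|c c0 cAB] := @invertible_bounded_below _ _ A B 1 1.
    by rewrite !scale1r.
  by exists c => // x; rewrite nA nB.
have powers n : bop_invertible (A + B) ->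
    bop_invertible (bop_abs A ^+ (2 ^ n) + bop_abs B ^+ (2 ^ n)).
  move=> /bounded_below_abs AB; apply: positiveD_invertible.
  - exact: positive_exp2.
  - exact: positive_exp2.
  - exact: bounded_below_exp2.
(* The exponents 2 and 1 are the cases n = 1 and n = 0 of [powers]. *)
split; [exact: (powers 1%N)|split=> [AB|Apos Bpos a b AB]].
  by split=> [|n]; [exact: (powers 0%N)|exact: powers].
by apply: positiveD_invertible => //; exact: invertible_bounded_below AB.
Qed.
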